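(* Let the pdNCG method (described in the context) be run with a constant CG tolerance $\eta$, $0\le\eta<1$, and let $0<\varpi\le c_5$, where $c_5$ is defined in the context. Let $x^*$ be the minimizer of $f$. Starting from an initial point $x^0$ such that $\|d^0\|_{x^0}\ge\varpi$, pdNCG requires at most $$K_1=c_6\log\Big(\frac{f(x^0)-f(x^* )}{c_7\varpi^2}\Big)$$ iterations (rounded up to an integer) to obtain a point $x^k$, $k>0$, such that $\|d^k\|_{x^k}<\varpi$, where $$c_6=\frac{2\kappa^2}{(1-\eta^2)^2c_2c_3}\quad\text{and}\quad c_7=\frac{1}{2\kappa}.$$ That is, there is an integer $k$ with $0<k\le\lceil K_1\rceil$ and $\|d^k\|_{x^k}<\varpi$.
   Context: Problem. Let $\tau>0$, $\mu>0$, and let $\varphi:\mathbb{R}^m\to\mathbb{R}$ be twice differentiable with $\lambda_m I\preceq\nabla^2\varphi(x)\preceq\lambda_1 I$ for all $x$, where $0<\lambda_m\le\lambda_1$, and $\|\nabla^2\varphi(y)-\nabla^2\varphi(x)\|\le L_\varphi\|y-x\|$ for all $x,y$, where $L_\varphi\ge0$. Here $\|\cdot\|$ is the Euclidean norm for vectors and the spectral norm for matrices. Let $\psi_\mu(x)=\sum_{i=1}^m\big((\mu^2+x_i^2)^{1/2}-\mu\big)$ and $f(x)=\tau\psi_\mu(x)+\varphi(x)$. Notation. $D=D(x)$ is the diagonal matrix with $[D]_{ii}=(\mu^2+x_i^2)^{-1/2}$. For $x,y\in\mathbb{R}^m$, $H(x,y)=\tau D(I-D\,\mathrm{diag}(x)\mathrm{diag}(y))+\nabla^2\varphi(x)$,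 where $D=D(x)$. At iterate $(x^k,y^k)$ the local norm is $\|v\|_{x^k}=\sqrt{v^\intercal H(x^k,y^k)v}$. Constants: $\tilde\lambda_1=\tau/\mu+\lambda_1$, $\kappa=\tilde\lambda_1/\lambda_m$, $L=\tau/\mu^2+L_\varphi$. $M>0$ is a constant bounding the derivative of $H$ on $\mathbb{R}^m\times\{\|y\|_\infty\le1\}$, in the sense that $\|H(x,y)-H(x',y')\|\le M(\|x-x'\|+\|y-y'\|)$ for all $x,x'\in\mathbb{R}^m$ and all $y,y'$ with $\|y\|_\infty,\|y'\|_\infty\le1$. Further, $$\gamma=\frac{8\tilde\lambda_1^{1/2}}{\lambda_m}\Big(L+M+\frac M\mu\Big)+\frac{M}{\lambda_m^{1/2}\mu},\qquad c_5=\min\Big\{3(1-2c_2)\frac{\lambda_m^{3/2}}{L},\ \frac{\lambda_m^{3/2}}{16\tilde\lambda_1\lambda_m+2\gamma\lambda_m^{1/2}+L}\Big\}.$$ Algorithm pdNCG. Constants: $0<c_2<1/2$, $0<c_3<1$. Start from $x^0\in\mathbb{R}^m$ and $y^0\in\mathbb{R}^m$ with $\|y^0\|_\infty\le1$. For $k=0,1,2,\dots$: (i) Compute $d^k$ by applying the conjugate gradients (CG) method, in exact arithmetic and started from the zero vector, to $H(x^k,y^k)d=-\nabla f(x^k)$, stopping when the CG iterate $d$ satisfies $\|H(x^k,y^k)d+\nabla f(x^k)\|\le\eta\|\nabla f(x^k)\|$. (ii) With $D=D(x^k)$, set $\Delta y^k=D(I-D\,\mathrm{diag}(x^k)\mathrm{diag}(y^k))d^k-(y^k-Dx^k)$.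 (iii) Set $\tilde y^{k+1}=y^k+\Delta y^k$ and let $y^{k+1}$ be the orthogonal projection of $\tilde y^{k+1}$ onto $\{y:\|y\|_\infty\le1\}$. (iv) Find the least integer $j\ge0$ with $f(x^k+c_3^jd^k)\le f(x^k)-c_2c_3^j\|d^k\|_{x^k}^2$ and set $\alpha=c_3^j$. (v) Set $x^{k+1}=x^k+\alpha d^k$. The sequences are regarded as infinite (no stopping test). *)

(* Defs.v *)
From HB Require Import structures.
From mathcomp Require Import all_boot all_order all_algebra.
From mathcomp Require Import all_classical all_reals all_analysis.

Set Implicit Arguments.
Unset Strict Implicit.
Unset Printing Implicit Defensive.

Import Order.TTheory GRing.Theory Num.Theory.
Import numFieldNormedType.Exports.

Local Open Scope classical_set_scope.
Local Open Scope ring_scope.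

(* On 'cV[R]_m the notation `|v| is the library's entrywise maximum norm
   (mx_norm), i.e. the infinity norm of v; it also induces the topology used
   by [differentiable], which is the usual one of R^m. *)

Section Euclidean.
Context {R : realType} {m : nat}.
Implicit Types (u v : 'cV[R]_m) (A B : 'M[R]_m) (g : 'cV[R]_m -> R).

Definition dot u v : R := (u^T *m v) 0 0.

Definition enorm v : R := Num.sqrt (\sum_(i < m) v i 0 ^+ 2).

Definition spectral_norm A : R := sup [set enorm (A *m v) | v in [set v | enorm v <= 1]].

Definition loewner_le A B : Prop := forall v, 0 <= dot v ((B - A) *m v).

Definition basis_vec (i : 'I_m) : 'cV[R]_m := delta_mx i 0.

Definition grad g (x : 'cV[R]_m) : 'cV[R]_m := \col_i 'D_(basis_vec i) g x.

Definition hess g (x : 'cV[R]_m) : 'M[R]_m :=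
  \matrix_(i, j) 'D_(basis_vec j) (fun z => grad g z i 0) x.

Definition twice_differentiable g : Prop :=
  (forall x, differentiable g x) /\ (forall x, differentiable (grad g) x).

Definition is_projection (C : set 'cV[R]_m) u v : Prop :=
  C v /\ forall w, C w -> enorm (u - v) <= enorm (u - w).

(* The state is (iterate, residual b - A d, search direction).  When the
   residual is 0 the quotients below are 0 / 0 = 0 and the state is constant;
   [cg_output] only looks at iterates up to the first one that passes the
   stopping test, which a zero residual always does when 0 <= tol. *)
Definition cg_step A (s : 'cV[R]_m * 'cV[R]_m * 'cV[R]_m) :=
  let: (d, r, p) := s in
  let a := dot r r / dot p (A *m p) in
  let r' := r - a *: (A *m p) in
  (d + a *: p, r', r' + (dot r' r' / dot r r) *: p).

Definition cg_iterate A b n : 'cV[R]_m := (iter n (cg_step A) (0, b, b)).1.1.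

Definition cg_output A b (tol : R) d : Prop :=
  exists n, [/\ d = cg_iterate A b n,
    enorm (A *m d - b) <= tol &
    forall n', (n' < n)%N -> ~ enorm (A *m cg_iterate A b n' - b) <= tol].

End Euclidean.

Section Problem.
Context {R : realType} {m : nat}.
Variables (tau mu : R) (phi : 'cV[R]_m -> R).
Implicit Types x y d : 'cV[R]_m.

Definition pseudo_huber x : R :=
  \sum_(i < m) (Num.sqrt (mu ^+ 2 + x i 0 ^+ 2) - mu).

Definition objective x : R := tau * pseudo_huber x + phi x.

Definition Dmat x : 'M[R]_m :=
  diag_mx (\row_i (Num.sqrt (mu ^+ 2 + x i 0 ^+ 2))^-1).

(* D (I - D diag(x) diag(y)) *)
Definition Dxy x y : 'M[R]_m :=
  Dmat x *m (1%:M - Dmat x *m diag_mx x^T *m diag_mx y^T).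

Definition Hmat x y : 'M[R]_m := tau *: Dxy x y + hess phi x.

Definition local_norm x y d : R := Num.sqrt (dot d (Hmat x y *m d)).

Definition sufficient_decrease (c2 c3 : R) x y d (j : nat) : Prop :=
  objective (x + c3 ^+ j *: d)
    <= objective x - c2 * c3 ^+ j * local_norm x y d ^+ 2.

Record pdNCG_run (c2 c3 eta : R) (x y d : nat -> 'cV[R]_m) : Prop := {
  run_y0 : `|y 0%N| <= 1 ;
  run_cg : forall k,
    cg_output (Hmat (x k) (y k)) (- grad objective (x k))
      (eta * enorm (grad objective (x k))) (d k) ;
  run_dual : forall k,
    is_projection [set z | `|z| <= 1]
      (y k + (Dxy (x k) (y k) *m d k - (y k - Dmat (x k) *m x k)))
      (y k.+1) ;
  run_primal : forall k, exists j,
    [/\ sufficient_decrease c2 c3 (x k) (y k) (d k) j,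
      forall j', (j' < j)%N -> ~ sufficient_decrease c2 c3 (x k) (y k) (d k) j' &
      x k.+1 = x k + c3 ^+ j *: d k]
}.

End Problem.

Section Constants.
Context {R : realType}.

Definition tlam1 (tau mu lam1 : R) : R := tau / mu + lam1.

Definition kappa (tau mu lam1 lamm : R) : R := tlam1 tau mu lam1 / lamm.

Definition Lconst (tau mu Lphi : R) : R := tau / mu ^+ 2 + Lphi.

Definition gamma_const (tau mu lam1 lamm Lphi M : R) : R :=
  8 * tlam1 tau mu lam1 `^ (1 / 2) / lamm * (Lconst tau mu Lphi + M + M / mu)
  + M / (lamm `^ (1 / 2) * mu).

Definition c5 (tau mu lam1 lamm Lphi M c2 : R) : R :=
  let L := Lconst tau mu Lphi in
  let gamma := gamma_const tau mu lam1 lamm Lphi M in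
  Num.min
    (3 * (1 - 2 * c2) * (lamm `^ (3 / 2) / L))
    (lamm `^ (3 / 2)
      / (16 * tlam1 tau mu lam1 * lamm + 2 * gamma * lamm `^ (1 / 2) + L)).

Definition c6 (tau mu lam1 lamm c2 c3 eta : R) : R :=
  2 * kappa tau mu lam1 lamm ^+ 2 / ((1 - eta ^+ 2) ^+ 2 * c2 * c3).

Definition c7 (tau mu lam1 lamm : R) : R := 1 / (2 * kappa tau mu lam1 lamm).

End Constants.

(* Main.v *)
Require Import Defs.
From HB Require Import structures.
From mathcomp Require Import all_boot all_order all_algebra.
From mathcomp Require Import all_classical all_reals all_analysis.
From mathcomp Require Import ring lra.

Import Order.TTheory GRing.Theory Num.Theory.
Import numFieldNormedType.Exports.

Local Open Scope classical_set_scope.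
Local Open Scope ring_scope.

(* Write E for the squared local norm of the direction d and g for the gradient
   of f.  The CG residual r = -g - H d is orthogonal to d and, once a step has
   been made, to g.  Hence g.d = -E, and |H d| >= |g| gives
   |g|^2 <= 2 tlam1 E.  Strong convexity turns this into f(x) - f* <= kappa E,
   while the quadratic upper model of f with curvature tlam1 shows both that
   backtracking stops with a step of length at least c3 / kappa, decreasing f by
   c2 c3 E / kappa, and that E / (2 kappa) < f(x) - f*.  So as long as
   E >= varpi^2 the gap f(x) - f* exceeds c7 varpi^2 and contracts by a factor
   1 - 2 / c6. *)

(** * Algebra of the Euclidean inner product *)

Section DotProduct.
Context {R : realType} {m : nat}.
Implicit Types (u v w : 'cV[R]_m) (A : 'M[R]_m).

Lemma dotE u v : dot u v = \sum_i u i 0 * v i 0.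
Proof. by rewrite /dot mxE; apply: eq_bigr => i _; rewrite mxE. Qed.

Lemma dotC u v : dot u v = dot v u.
Proof. by rewrite !dotE; apply: eq_bigr => i _; rewrite mulrC. Qed.

Lemma dotDl u v w : dot (u + v) w = dot u w + dot v w.
Proof. by rewrite /dot linearD mulmxDl mxE. Qed.

Lemma dotDr u v w : dot w (u + v) = dot w u + dot w v.
Proof. by rewrite dotC dotDl !(dotC w). Qed.

Lemma dotZl a u v : dot (a *: u) v = a * dot u v.
Proof. by rewrite /dot linearZ -scalemxAl mxE. Qed.

Lemma dotZr a u v : dot u (a *: v) = a * dot u v.
Proof. by rewrite dotC dotZl dotC. Qed.

Lemma dotNl u v : dot (- u) v = - dot u v.
Proof. by rewrite -scaleN1r dotZl mulN1r. Qed.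

Lemma dotNr u v : dot u (- v) = - dot u v.
Proof. by rewrite dotC dotNl dotC. Qed.

Lemma dotBr u v w : dot w (u - v) = dot w u - dot w v.
Proof. by rewrite dotDr dotNr. Qed.

Lemma dotBl u v w : dot (u - v) w = dot u w - dot v w.
Proof. by rewrite dotDl dotNl. Qed.

Lemma dot0l u : dot 0 u = 0.
Proof. by rewrite -(scale0r u) dotZl mul0r. Qed.

Lemma dot0r u : dot u 0 = 0.
Proof. by rewrite dotC dot0l. Qed.

Lemma dot_ge0 u : 0 <= dot u u.
Proof. by rewrite dotE sumr_ge0 // => i _; rewrite -expr2 sqr_ge0. Qed.

Lemma dot_eq0 u : (dot u u == 0) = (u == 0).
Proof.
apply/eqP/eqP => [|->]; last by rewrite dot0l.
rewrite dotE => /eqP; rewrite psumr_eq0; last by move=> i _; rewrite -expr2 sqr_ge0.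
move=> /allP u0; apply/matrixP => i j; rewrite (ord1 j) mxE.
by have := u0 i (mem_index_enum _); rewrite -expr2 sqrf_eq0 => /eqP.
Qed.

Lemma dot_gt0 u : (0 < dot u u) = (u != 0).
Proof. by rewrite lt_neqAle dot_ge0 andbT eq_sym dot_eq0. Qed.

Lemma enorm_dot u : enorm u = Num.sqrt (dot u u).
Proof. by rewrite /enorm dotE; under eq_bigr do rewrite expr2. Qed.

Lemma dot_mx_basis A i j : dot (basis_vec i) (A *m basis_vec j) = A i j.
Proof.
by rewrite /basis_vec -colE dotE (bigD1 i) //= big1 => [|k /negbTE ki];
  rewrite !mxE ?ki ?eqxx ?mul0r // mul1r addr0.
Qed.

Lemma dot_symmx A u v : A^T = A -> dot u (A *m v) = dot v (A *m u).
Proof. by move=> sA; rewrite dotC /dot trmx_mul sA mulmxA. Qed.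

(* Cauchy-Schwarz for the form [dot _ (A *m _)], applied to [A *m u] and [u]. *)
Lemma dot_mulmx_le A (C : R) u : A^T = A -> (forall v, 0 <= dot v (A *m v)) ->
  (forall v, dot v (A *m v) <= C * dot v v) -> 0 < C ->
  dot (A *m u) (A *m u) <= C * dot u (A *m u).
Proof.
move=> sA A0 AC C0; set w := A *m u.
have h := A0 (w - C *: u).
have h2 := AC w.
rewrite mulmxBr -scalemxAr -/w dotBl !dotBr !dotZr !dotZl in h.
rewrite (dot_symmx _ u w sA) -/w in h.
have : C * dot w w <= C * (C * dot u w) by lra.
by rewrite ler_pM2l.
Qed.

End DotProduct.

(** * Orthogonality relations of conjugate gradients *)

Section ConjugateGradients.
Context {R : realType} {m : nat}.
Variables (A : 'M[R]_m) (b : 'cV[R]_m).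
Hypothesis sA : A^T = A.
Hypothesis pdA : forall v, v != 0 -> 0 < dot v (A *m v).

Let st n := iter n (cg_step A) (0, b, b).
Let d n := (st n).1.1.
Let r n := (st n).1.2.
Let p n := (st n).2.
Let a n := dot (r n) (r n) / dot (p n) (A *m p n).
Let beta n := dot (r n.+1) (r n.+1) / dot (r n) (r n).

Let dS n : d n.+1 = d n + a n *: p n.
Proof. by rewrite /d /a /p /r /st /=; case: (iter _ _ _) => [[? ?] ?]. Qed.
Let rS n : r n.+1 = r n - a n *: (A *m p n).
Proof. by rewrite /d /a /p /r /st /=; case: (iter _ _ _) => [[? ?] ?]. Qed.
Let pS n : p n.+1 = r n.+1 + beta n *: p n.
Proof. by rewrite /beta /d /a /p /r /st /=; case: (iter _ _ _) => [[? ?] ?]. Qed.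

Let cg_residualE n : r n = b - A *m d n.
Proof.
elim: n => [|n IH]; first by rewrite /r /d /= mulmx0 subr0.
by rewrite rS dS IH mulmxDr -scalemxAr opprD addrA.
Qed.

(** The three relations feed each other, so a single induction carries them. Nonzero earlier
    residuals keep the quotients [a i] and [beta i] genuine. *)
Let cg_orthogonal n : (forall i, (i < n)%N -> r i != 0) ->
  [/\ forall i, (i < n)%N -> dot (r n) (p i) = 0,
      forall i, (i < n)%N -> dot (p n) (A *m p i) = 0 &
      dot (r n) (p n) = dot (r n) (r n)].
Proof.
elim: n => [//|n IH] rn0.
have [|rp pAp rpn] := IH; first by move=> i ?; apply: rn0; rewrite ltnS ltnW.
have rn : dot (r n) (r n) != 0 by rewrite dot_eq0 rn0.
have pn : p n != 0.
  by apply: contraNneq rn => pn; rewrite -rpn pn dot0r.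
have pApn : dot (p n) (A *m p n) != 0 by rewrite gt_eqF // pdA.
have rp' i : (i < n.+1)%N -> dot (r n.+1) (p i) = 0.
  rewrite ltnS leq_eqVlt rS dotBl dotZl => /orP[/eqP->|lin].
    by rewrite rpn [dot (A *m _) _]dotC /a mulfVK // subrr.
  by rewrite rp // [dot (A *m _) _]dotC (dot_symmx _ _ _ sA) pAp // mulr0 subrr.
(* Each later residual is its direction minus a multiple of the previous direction, so orthogonality
   passes from directions to residuals. *)
have rr i : (i < n.+1)%N -> dot (r n.+1) (r i) = 0.
  case: i => [|i] li; first by have := rp' 0%N li.
  have := rp' i.+1 li; rewrite pS dotDr dotZr (rp' i) ?mulr0 ?addr0 //.
  exact: ltnW.
split=> //; last by rewrite {1}pS dotDr dotZr rp' // mulr0 addr0.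
move=> i; rewrite ltnS leq_eqVlt pS dotDl dotZl => /orP[/eqP->|lin].
  (* Scaled by [a n], [A *m p n] is a difference of successive residuals. Conjugacy thus reduces to
     orthogonality of residuals, and [beta n] cancels what remains. *)
  have an : a n != 0 by rewrite mulf_neq0 ?invr_eq0.
  apply: (mulfI an); rewrite mulr0 mulrDr -(dotZr (a n)).
  have -> : a n *: (A *m p n) = r n - r n.+1 by rewrite rS opprB addrC subrK.
  rewrite dotBr rr // sub0r mulrCA /a mulfVK // /beta mulfVK //.
  by rewrite addNr.
rewrite pAp // mulr0 addr0.
have [->|pi0] := eqVneq (p i) 0; first by rewrite mulmx0 dot0r.
have ai : a i != 0.
  rewrite mulf_neq0 ?invr_eq0 ?dot_eq0 ?rn0 ?gt_eqF ?pdA //.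
  exact: (ltn_trans lin).
apply: (mulfI ai); rewrite mulr0 -(dotZr (a i)).
have -> : a i *: (A *m p i) = r i - r i.+1 by rewrite rS opprB addrC subrK.
by rewrite dotBr !rr ?subrr // ltnW.
Qed.

(** The output is a combination of the directions used so far, all orthogonal to the current
    residual. The first of them is [b], whence the second claim once a step has been made. *)
Lemma cg_output_orthogonal (tol : R) v : 0 <= tol -> cg_output A b tol v ->
  dot v (b - A *m v) = 0 /\ (v = 0 \/ dot b (b - A *m v) = 0).
Proof.
move=> tol0 [n [-> _ nstop]]; rewrite -[cg_iterate A b n]/(d n) -cg_residualE.
(* A zero residual would have passed the stopping test earlier, since [tol] is nonnegative. *)
have rn0 i : (i < n)%N -> r i != 0.
  move=> /nstop; apply: contra_notN => /eqP ri.
  rewrite -[cg_iterate A b i]/(d i) -opprB -cg_residualE ri oppr0.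
  by rewrite enorm_dot dot0l sqrtr0.
have [rp _ _] := cg_orthogonal n rn0.
split; last first.
  by case: n rp {rn0 nstop} => [|n] rp; [left | right; rewrite dotC (rp 0%N)].
suff H k : (k <= n)%N -> dot (d k) (r n) = 0 by exact: H.
elim: k => [|k IH] kn; first by rewrite dot0l.
by rewrite dS dotDl dotZl IH ?(ltnW kn) // dotC rp // mulr0 addr0.
Qed.

End ConjugateGradients.

(** * Second-order Taylor bounds and symmetry of the Hessian *)

Section SecondOrder.
Context {R : realType} {m : nat}.
Implicit Types (g : 'cV[R]_m -> R) (x z u v h : 'cV[R]_m).

Lemma derive_grad g x h : differentiable g x -> 'D_h g x = dot (grad g x) h.
Proof.
move=> dg; rewrite deriveE //.
have -> : h = \sum_i h i 0 *: basis_vec i :> 'cV[R]_m.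
  by rewrite [LHS]matrix_sum_delta; apply: eq_bigr => i _; rewrite big_ord1.
rewrite linear_sum /= dotE; apply: eq_bigr => i _.
rewrite linearZ /= mxE deriveE // mulrC; congr (_ * _).
rewrite summxE (bigD1 i) //= big1 ?addr0 => [|j /negbTE ji]; rewrite !mxE.
  by rewrite !eqxx mulr1.
by rewrite eq_sym ji mulr0.
Qed.

Lemma is_derive_line g z h t : differentiable g (z + t *: h) ->
  is_derive t (1 : R) (fun s => g (z + s *: h)) (dot (grad g (z + t *: h)) h).
Proof.
move=> dg; rewrite -derive_grad //.
have E : (fun e : R => e^-1 *: (g (e *: h + (z + t *: h)) - g (z + t *: h)))
  = (fun e : R => e^-1 *: (((fun s => g (z + s *: h)) \o shift t) (e *: 1)
      - g (z + t *: h))).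
  apply: boolp.funext => e /=; congr (_ *: (g _ - _)).
  by rewrite [e *: 1]mulr1 scalerDl addrCA.
apply: DeriveDef; last by rewrite /derive -E.
by have := diff_derivable (v := h) dg; rewrite /derivable /= E.
Qed.

Let differentiable_grad_entry g x i : differentiable (grad g) x ->
  differentiable (fun z => grad g z i 0) x.
Proof.
move=> dg; apply: (@differentiable_comp _ _ _ _ (grad g)
  (fun N : 'cV[R]_m => N i 0 : R)) => //.
exact: differentiable_coord.
Qed.

Let dot_gradE g u : (fun z => dot (grad g z) u)
  = \sum_i (u i 0 *: (fun z => grad g z i 0)).
Proof.
apply: boolp.funext => z; rewrite fct_sumE dotE.
by apply: eq_bigr => i _; rewrite mulrC.
Qed.

Lemma differentiable_dot_grad g x u : differentiable (grad g) x ->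
  differentiable (fun z => dot (grad g z) u) x.
Proof.
move=> dg; rewrite dot_gradE; apply: differentiable_sum => i.
exact/differentiableZ/differentiable_grad_entry.
Qed.

Lemma grad_dot_grad g x u : differentiable (grad g) x ->
  grad (fun z => dot (grad g z) u) x = (hess g x)^T *m u.
Proof.
move=> dg; apply/matrixP => j k; rewrite (ord1 k) dot_gradE !mxE.
have dgi i := diff_derivable (v := basis_vec j) (differentiable_grad_entry g x i dg).
rewrite derive_sum; last by move=> i; exact: derivableZ.
by apply: eq_bigr => i _; rewrite deriveZ // !mxE /GRing.scale /= mulrC.
Qed.

Lemma is_derive_dot_grad g z h u t : twice_differentiable g ->
  is_derive t (1 : R) (fun s => dot (grad g (z + s *: h)) u)
    (dot u (hess g (z + t *: h) *m h)).
Proof.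
move=> [_ dg].
have := is_derive_line (fun z => dot (grad g z) u) z h t.
rewrite grad_dot_grad // /dot trmx_mul trmxK -mulmxA; apply.
exact: differentiable_dot_grad.
Qed.

Lemma derivable1_MVT (f df : R -> R) (a b : R) : a < b ->
  (forall t, is_derive t (1 : R) f (df t)) ->
  exists c, [/\ a < c, c < b & f b - f a = df c * (b - a)].
Proof.
move=> ab fdf; have [|c] := @MVT R f df a b ab (fun t _ => fdf t).
  by apply: derivable_within_continuous.
by rewrite in_itv /= => /andP[ac cb]; exists c.
Qed.

Lemma taylor2_le (f df ddf : R -> R) (C : R) :
  (forall t, is_derive t (1 : R) f (df t)) ->
  (forall t, is_derive t (1 : R) df (ddf t)) ->
  (forall t, ddf t <= C) -> f 1 <= f 0 + df 0 + C / 2.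
Proof.
move=> fdf dfddf ddfC.
pose F t := f t - df 0 * t - C / 2 * t ^+ 2.
(* By a second mean value step, the derivative of [F] at [c] is [c * (ddf e - C)], hence
   nonpositive, so [F 1 <= F 0]. *)
have [|c [c0 c1]] := @derivable1_MVT F (fun t => df t - df 0 - C * t) 0 1 ltr01.
  move=> t; apply: is_derive_eq.
  suff : df t - df 0 * 1 - C / 2 * (t * 1 + t * 1) = df t - df 0 - C * t by [].
  by field.
have [e [e0 ec]] := derivable1_MVT df ddf 0 c c0 dfddf.
rewrite /F => h1 h2; have := ddfC e; nra.
Qed.

Lemma taylor2_ge (f df ddf : R -> R) (C : R) :
  (forall t, is_derive t (1 : R) f (df t)) ->
  (forall t, is_derive t (1 : R) df (ddf t)) ->
  (forall t, C <= ddf t) -> f 0 + df 0 + C / 2 <= f 1.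
Proof.
move=> fdf dfddf ddfC.
have := @taylor2_le (- f) (- df) (- ddf) (- C); rewrite !fctE => H.
suff : - f 1 <= - f 0 + - df 0 + - C / 2 by lra.
by apply: H => t; rewrite ?lerN2.
Qed.

Lemma quadratic_upper_bound g (C : R) z h : twice_differentiable g ->
  (forall x, loewner_le (hess g x) C%:M) ->
  g (z + h) <= g z + dot (grad g z) h + C / 2 * dot h h.
Proof.
move=> dg gC.
have := taylor2_le (fun s => g (z + s *: h)) (fun s => dot (grad g (z + s *: h)) h)
  (fun s => dot h (hess g (z + s *: h) *m h)) (C * dot h h).
rewrite !scale1r !scale0r !addr0 mulrAC; apply=> t.
- by apply: is_derive_line; apply: dg.1.
- exact: is_derive_dot_grad.
- by have := gC (z + t *: h) h; rewrite mulmxBl mul_scalar_mx dotBr dotZr subr_ge0.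
Qed.

Lemma quadratic_lower_bound g (C : R) z h : twice_differentiable g ->
  (forall x, loewner_le C%:M (hess g x)) ->
  g z + dot (grad g z) h + C / 2 * dot h h <= g (z + h).
Proof.
move=> dg gC.
have := taylor2_ge (fun s => g (z + s *: h)) (fun s => dot (grad g (z + s *: h)) h)
  (fun s => dot h (hess g (z + s *: h) *m h)) (C * dot h h).
rewrite !scale1r !scale0r !addr0 mulrAC; apply=> t.
- by apply: is_derive_line; apply: dg.1.
- exact: is_derive_dot_grad.
- by have := gC (z + t *: h) h; rewrite mulmxBl mul_scalar_mx dotBr dotZr subr_ge0.
Qed.

Lemma dot_grad_expansion g x u (e : R) : twice_differentiable g -> 0 < e ->
  exists2 del : R, 0 < del & forall w, `|w| < del ->
    `|dot (grad g (x + w)) u - dot (grad g x) u - dot u (hess g x *m w)|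
      <= e * `|w|.
Proof.
move=> [_ dg] e0.
have dG := differentiable_dot_grad g x u (dg x).
have /diff_locallyP[_ /eqaddoP /(_ _ e0)] := dG.
case/nbhs_ballP => del /= del0 H; exists del => // w wdel.
have := H w; rewrite -ball_normE /= sub0r normrN => /(_ wdel).
rewrite !fctE /= -deriveE // derive_grad // grad_dot_grad //.
by rewrite /dot trmx_mul trmxK -mulmxA [w + x]addrC opprD addrA.
Qed.

(* Schwarz's theorem: the second difference is symmetric in [u] and [v], while the
   mean value theorem and differentiability of the gradient at [x] give the limit
   [dot u (hess g x *m v)] for its quotient by [t ^+ 2]. *)
Let second_difference g x u v : R :=
  g (x + u + v) - g (x + u) - (g (x + v) - g x).

Let second_differenceP g x u v (e : R) : twice_differentiable g -> 0 < e ->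
  exists2 del : R, 0 < del & forall t : R, 0 < t -> t < del ->
    `|second_difference g x (t *: u) (t *: v) - t ^+ 2 * dot u (hess g x *m v)|
      <= e * t ^+ 2.
Proof.
(* For [0 < s < t], both [s *: u] and [t *: v + s *: u] have norm at most [t * C / 2]. Two
   expansions with tolerance [e / C] then cost at most [e * t] together; the [+ 1] makes [C]
   positive. *)
move=> dg e0; pose C : R := 2 * (`|u| + `|v| + 1).
have C0 : 0 < C by rewrite mulr_gt0 // ltr_wpDl // addr_ge0.
have [del del0 H] := dot_grad_expansion g x u (e / C) dg (divr_gt0 e0 C0).
exists (del / C) => [|t t0]; first exact: divr_gt0.
rewrite ltr_pdivlMr // => tdel.
pose k s := g (x + t *: v + s *: u) - g (x + s *: u).
pose dk s := dot (grad g (x + t *: v + s *: u)) u - dot (grad g (x + s *: u)) u.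
have [s|s [s0 st]] := derivable1_MVT k dk 0 t t0.
  by apply: is_deriveB; apply: is_derive_line; apply: dg.1.
have -> : k t - k 0 = second_difference g x (t *: u) (t *: v).
  rewrite /k /second_difference scale0r !addr0.
  by rewrite -!addrA [t *: v + _]addrC.
move=> ->; rewrite subr0.
have nw1 : `|t *: v + s *: u| <= t * C / 2.
  rewrite (le_trans (ler_normD _ _)) // !normrZ !gtr0_norm //.
  have := normr_ge0 u; have := normr_ge0 v; rewrite /C; nra.
have nw2 : `|s *: u| <= t * C / 2.
  rewrite normrZ gtr0_norm //.
  have := normr_ge0 u; have := normr_ge0 v; rewrite /C; nra.
have wdel : t * C / 2 < del by nra.
have := H _ (le_lt_trans nw1 wdel); have := H _ (le_lt_trans nw2 wdel).
rewrite addrA /dk mulmxDr dotDr -!scalemxAr !dotZr.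
set a := dot (grad g (x + s *: u)) u; set b := dot (grad g (x + t *: v + _)) u.
set c := dot (grad g x) u; set p := dot u (_ *m v); set q := s * _.
move=> h1 h2.
have eC : e / C * (t * C / 2) = e * t / 2 by field; rewrite gt_eqF.
have h1' : `|a - c - q| <= e * t / 2.
  by rewrite (le_trans h1) // -eC ler_wpM2l // ltW // divr_gt0.
have h2' : `|b - c - (t * p + q)| <= e * t / 2.
  by rewrite (le_trans h2) // -eC ler_wpM2l // ltW // divr_gt0.
(* The linear terms along [u], equal to [q] in both expansions, cancel; only the [v] term [t * p]
   survives. *)
have -> : (b - a) * t - t ^+ 2 * p = t * ((b - c - (t * p + q)) - (a - c - q)).
  ring.
rewrite normrM gtr0_norm // [e * _]mulrC expr2 -mulrA ler_pM2l //.
rewrite (le_trans (ler_normB _ _)) //; lra.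
Qed.

Lemma hess_sym g x : twice_differentiable g -> (hess g x)^T = hess g x.
Proof.
move=> dg; apply/matrixP => i j; rewrite mxE -!dot_mx_basis.
set u := basis_vec j; set v := basis_vec i.
apply/eqP; rewrite -subr_eq0 -normr_le0; apply/ler_addgt0Pr => e e0.
rewrite add0r.
have e20 : 0 < e / 2 by rewrite divr_gt0.
have [d1 d10 H1] := second_differenceP g x u v (e / 2) dg e20.
have [d2 d20 H2] := second_differenceP g x v u (e / 2) dg e20.
pose t := Num.min d1 d2 / 2.
have t0 : 0 < t by rewrite divr_gt0 // lt_min d10 d20.
have tm : t < Num.min d1 d2 by rewrite /t; have : 0 < t by []; rewrite /t; lra.
have /andP[t1 t2] : (t < d1) && (t < d2) by rewrite -lt_min.
have := H1 t t0 t1; have := H2 t t0 t2.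
have -> : second_difference g x (t *: v) (t *: u)
        = second_difference g x (t *: u) (t *: v).
  by rewrite /second_difference -!addrA [t *: v + t *: u]addrC; ring.
set S := second_difference _ _ _ _; set p := dot u _; set q := dot v _.
move=> h2 h1; have t20 : 0 < t ^+ 2 by rewrite exprn_gt0.
rewrite -(ler_pM2l t20) -[t ^+ 2 in leLHS]gtr0_norm // -normrM.
have -> : t ^+ 2 * (p - q) = (S - t ^+ 2 * q) - (S - t ^+ 2 * p) by ring.
rewrite (le_trans (ler_normB _ _)) //; lra.
Qed.

End SecondOrder.

(** * Tangent and quadratic bounds for the scalar pseudo-Huber function *)

Section PseudoHuber.
Context {R : realType}.
Implicit Types (mu a h : R).

Let sqrt_sum_gt0 mu a : 0 < mu -> 0 < Num.sqrt (mu ^+ 2 + a ^+ 2).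
Proof. by move=> mu0; rewrite sqrtr_gt0 ltr_wpDr ?sqr_ge0 ?exprn_gt0. Qed.

Lemma le_sqrt_sum_sqr mu a : 0 < mu -> mu <= Num.sqrt (mu ^+ 2 + a ^+ 2).
Proof.
move=> mu0; rewrite -[leLHS]gtr0_norm // -sqrtr_sqr ler_sqrt ?lerDl ?sqr_ge0 //.
by rewrite addr_ge0 ?sqr_ge0.
Qed.

Lemma abs_le_sqrt_sum_sqr mu a : `|a| <= Num.sqrt (mu ^+ 2 + a ^+ 2).
Proof. by rewrite -sqrtr_sqr ler_sqrt ?lerDr ?sqr_ge0 // addr_ge0 ?sqr_ge0. Qed.

(** Multiplied by the root at [a], this is Cauchy-Schwarz for [(mu, a)] and [(mu, a + h)]; the
    squares of the two sides differ by [(mu * h) ^+ 2]. *)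
Lemma sqrt_sum_sqr_lower mu a h : 0 < mu ->
  Num.sqrt (mu ^+ 2 + a ^+ 2) + (Num.sqrt (mu ^+ 2 + a ^+ 2))^-1 * a * h
    <= Num.sqrt (mu ^+ 2 + (a + h) ^+ 2).
Proof.
move=> mu0; have s0 := sqrt_sum_gt0 mu a mu0; have t0 := sqrt_sum_gt0 mu (a + h) mu0.
have := sqr_sqrtr (addr_ge0 (sqr_ge0 mu) (sqr_ge0 a)).
have := sqr_sqrtr (addr_ge0 (sqr_ge0 mu) (sqr_ge0 (a + h))).
set s := Num.sqrt _ in s0 *; set t := Num.sqrt _ in t0 *; move=> t2 s2.
rewrite -(ler_pM2l s0) mulrDr mulrA mulrA mulfV ?gt_eqF // mul1r.
rewrite -expr2 s2; have [|lt0] := lerP 0 (mu ^+ 2 + a ^+ 2 + a * h); last first.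
  by move: (mulr_gt0 s0 t0); lra.
move=> c0; rewrite -(@ler_pXn2r _ 2) ?nnegrE ?mulr_ge0 ?(ltW s0) ?(ltW t0) //.
rewrite [leRHS]exprMn s2 t2.
have := sqr_ge0 (mu * h); nra.
Qed.

(** With curvature [1 / s] in place of [1 / mu], the quadratic model exceeds [t] by exactly
    [(t - s) ^+ 2 / (2 * s)]. If this vanishes then [a != 0], so [mu < s] and strictness comes from
    the curvature instead. *)
Lemma sqrt_sum_sqr_upper mu a h : 0 < mu -> h != 0 ->
  Num.sqrt (mu ^+ 2 + (a + h) ^+ 2)
    < Num.sqrt (mu ^+ 2 + a ^+ 2) + (Num.sqrt (mu ^+ 2 + a ^+ 2))^-1 * a * h
      + h ^+ 2 / (2 * mu).
Proof.
move=> mu0 h0; have s0 := sqrt_sum_gt0 mu a mu0.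
have t0 := sqrt_sum_gt0 mu (a + h) mu0.
have mus := le_sqrt_sum_sqr mu a mu0.
have := sqr_sqrtr (addr_ge0 (sqr_ge0 mu) (sqr_ge0 a)).
have := sqr_sqrtr (addr_ge0 (sqr_ge0 mu) (sqr_ge0 (a + h))).
set s := Num.sqrt _ in s0 mus *; set t := Num.sqrt _ in t0 *; move=> t2 s2.
have h20 : 0 < h ^+ 2 by rewrite exprn_even_gt0.
have : h ^+ 2 / (2 * s) <= h ^+ 2 / (2 * mu).
  by rewrite ler_pM2l // lef_pV2 ?posrE ?mulr_gt0 // ler_pM2l.
have E : s + s^-1 * a * h + h ^+ 2 / (2 * s) = t + (t - s) ^+ 2 / (2 * s).
  rewrite -(mulrA s^-1); have -> : a * h = (t ^+ 2 - s ^+ 2 - h ^+ 2) / 2 by rewrite t2 s2; field.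
  by field; rewrite gt_eqF.
have [ts|ts] := eqVneq t s; last first.
  have : 0 < (t - s) ^+ 2 / (2 * s).
    by rewrite divr_gt0 ?exprn_even_gt0 //= ?subr_eq0 // mulr_gt0.
  lra.
have a0 : a != 0.
  apply: contraTneq h20 => a0; move: t2; rewrite ts s2 a0 add0r; lra.
have {}mus : mu < s.
  rewrite -(@ltr_pXn2r _ 2) ?nnegrE ?(ltW mu0) ?(ltW s0) // s2 ltrDl.
  by rewrite exprn_even_gt0.
have : h ^+ 2 / (2 * s) < h ^+ 2 / (2 * mu).
  by rewrite ltr_pM2l // ltf_pV2 ?posrE ?mulr_gt0 // ltr_pM2l.
by rewrite ts subrr expr0n /= mul0r in E; lra.
Qed.

End PseudoHuber.

(** * Quadratic models of the objective and spectral bounds on [Hmat] *)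

Section Objective.
Context {R : realType} {m : nat}.
Implicit Types (x y z u v h c : 'cV[R]_m) (F : 'cV[R]_m -> R).

(** Reads the gradient off a two-sided quadratic estimate, so the square roots in the objective
    never have to be differentiated. *)
Lemma grad_quadratic F x c (K : R) :
  (forall h, `|F (x + h) - F x - dot c h| <= K * dot h h) -> grad F x = c.
Proof.
move=> FK; apply/matrixP => i j; rewrite (ord1 j) mxE; set v := basis_vec i.
have -> : c i 0 = dot c v.
  rewrite dotE (bigD1 i) //= big1 ?addr0 => [|k /negbTE ki]; rewrite !mxE ?ki.
    by rewrite !eqxx mulr1.
  by rewrite mulr0.
apply: cvg_lim => //; apply/cvgrPdist_le => /= e e0.
(* The difference quotient at [t] errs by at most [|t|] times [K * dot v v]; the [+ 1] avoids
   dividing by zero when choosing the radius. *)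
have K0 : 0 < `|K * dot v v| + 1 by rewrite ltr_wpDl.
near=> t.
have t0 : t != 0 by near: t; exact: nbhs_dnbhs_neq.
have te : `|t| < e / (`|K * dot v v| + 1).
  near: t; exact/dnbhs0_lt/divr_gt0.
have := FK (t *: v); rewrite dotZl !dotZr [x + _]addrC => H.
rewrite -(ler_pM2l (_ : 0 < `|t|)) ?normr_gt0 // -normrM mulrBr.
rewrite distrC mulVKf // (le_trans H) //.
have -> : K * (t * (t * dot v v)) = `|t| * (`|t| * (K * dot v v)).
  by rewrite [RHS]mulrA -normrM -expr2 ger0_norm ?sqr_ge0 //; ring.
rewrite ler_pM2l ?normr_gt0 //.
move: te; rewrite ltr_pdivlMr //.
have := ler_norm (K * dot v v); have := normr_ge0 t; nra.
Unshelve. all: by end_near. Qed.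

Variables (tau mu lam1 lamm : R) (phi : 'cV[R]_m -> R).
Hypotheses (tau_gt0 : 0 < tau) (mu_gt0 : 0 < mu) (lamm_gt0 : 0 < lamm).
Hypothesis phi_C : twice_differentiable phi.
Hypothesis hess_ge : forall z, loewner_le lamm%:M (hess phi z).
Hypothesis hess_le : forall z, loewner_le (hess phi z) lam1%:M.

Let s x i := Num.sqrt (mu ^+ 2 + x i 0 ^+ 2).

Let dot_Dmat x h : dot (Dmat mu x *m x) h = \sum_i (s x i)^-1 * x i 0 * h i 0.
Proof. by rewrite dotE; apply: eq_bigr => i _; rewrite mul_diag_mx !mxE. Qed.

Lemma pseudo_huber_lower x h :
  pseudo_huber mu x + dot (Dmat mu x *m x) h <= pseudo_huber mu (x + h).
Proof.
rewrite dot_Dmat /pseudo_huber -big_split /=; apply: ler_sum => i _.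
have := sqrt_sum_sqr_lower mu (x i 0) (h i 0) mu_gt0.
by rewrite -/(s x i) !mxE; lra.
Qed.

Lemma pseudo_huber_upper x h : h != 0 ->
  pseudo_huber mu (x + h)
    < pseudo_huber mu x + dot (Dmat mu x *m x) h + dot h h / (2 * mu).
Proof.
move=> h0; rewrite dot_Dmat dotE /pseudo_huber mulr_suml -!big_split /=.
have H i : h i 0 != 0 -> Num.sqrt (mu ^+ 2 + (x + h) i 0 ^+ 2) - mu
    < s x i - mu + (s x i)^-1 * x i 0 * h i 0 + h i 0 * h i 0 / (2 * mu).
  move=> /(sqrt_sum_sqr_upper mu (x i 0) (h i 0) mu_gt0).
  by rewrite -/(s x i) !mxE -expr2; lra.
(* One nonzero coordinate makes the whole sum strict; the others contribute weak inequalities. *)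
have [i hi] : exists i, h i 0 != 0.
  apply/existsP; apply: contraNT h0; rewrite negb_exists => /forallP h0.
  by apply/eqP/matrixP => i j; rewrite (ord1 j) mxE; apply/eqP/negPn/h0.
rewrite (bigD1 i) //= [ltRHS](bigD1 i) //=; apply: ltr_leD; first exact: H.
apply: ler_sum => j _; have [hj|/H/ltW//] := eqVneq (h j 0) 0.
by rewrite !mxE hj !(addr0, mulr0, mul0r).
Qed.

(** The candidate gradient: both quadratic models are first proved with [g], and together they
    identify it as the gradient of the objective. *)
Let g x := tau *: (Dmat mu x *m x) + grad phi x.

Let objective_lower' x h : objective tau mu phi x + dot (g x) h + lamm / 2 * dot h h
  <= objective tau mu phi (x + h).
Proof.
have := quadratic_lower_bound phi lamm x h phi_C hess_ge.
have := pseudo_huber_lower x h; rewrite -(ler_pM2l tau_gt0).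
by rewrite /objective /g dotDl dotZl; lra.
Qed.

Let objective_upper' x h : h != 0 -> objective tau mu phi (x + h)
  < objective tau mu phi x + dot (g x) h + tlam1 tau mu lam1 / 2 * dot h h.
Proof.
move=> h0; have := quadratic_upper_bound phi lam1 x h phi_C hess_le.
have := pseudo_huber_upper x h h0; rewrite -(ltr_pM2l tau_gt0).
have -> : tlam1 tau mu lam1 / 2 * dot h h
   = tau * (dot h h / (2 * mu)) + lam1 / 2 * dot h h.
  by rewrite /tlam1; field; rewrite gt_eqF.
by rewrite /objective /g dotDl dotZl; lra.
Qed.

Lemma grad_objective x : grad (objective tau mu phi) x = g x.
Proof.
apply: (grad_quadratic _ _ _ (tlam1 tau mu lam1 / 2)) => h.
have [->|h0] := eqVneq h 0; first by rewrite addr0 subrr !dot0r subrr normr0 mulr0.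
have := objective_lower' x h; have := objective_upper' x h h0.
have : 0 <= lamm / 2 * dot h h by rewrite mulr_ge0 ?dot_ge0 // divr_ge0 // ltW.
by rewrite ler_norml => *; apply/andP; split; lra.
Qed.

Lemma objective_lower x h :
  objective tau mu phi x + dot (grad (objective tau mu phi) x) h
    + lamm / 2 * dot h h <= objective tau mu phi (x + h).
Proof. by rewrite grad_objective. Qed.

(* Strictness is what excludes K1 = 0 in the theorem. *)
Lemma objective_upper x h : h != 0 -> objective tau mu phi (x + h)
  < objective tau mu phi x + dot (grad (objective tau mu phi) x) h
    + tlam1 tau mu lam1 / 2 * dot h h.
Proof. by rewrite grad_objective; exact: objective_upper'. Qed.

Let q x y i := (s x i)^-1 * (1 - (s x i)^-1 * x i 0 * y i 0).

Let DxyE x y : Dxy mu x y = diag_mx (\row_i q x y i).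
Proof.
apply/matrixP => i j; rewrite /Dxy /Dmat mul_diag_mx -mulmxA mul_diag_mx mul_diag_mx.
rewrite !mxE /q /s; have [->|ij] := eqVneq i j; rewrite ?mulr1n ?mulr0n ?mulrA //.
by rewrite !mulr0 subr0 mulr0.
Qed.

Lemma Hmat_sym x y : (Hmat tau mu phi x y)^T = Hmat tau mu phi x y.
Proof. by rewrite /Hmat linearD linearZ /= DxyE tr_diag_mx hess_sym. Qed.

Let dot_Hmat x y v : dot v (Hmat tau mu phi x y *m v)
  = tau * (\sum_i q x y i * v i 0 ^+ 2) + dot v (hess phi x *m v).
Proof.
rewrite /Hmat mulmxDl -scalemxAl dotDr dotZr DxyE; congr (_ * _ + _).
by rewrite dotE; apply: eq_bigr => i _; rewrite mul_diag_mx !mxE; ring.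
Qed.

Let norm_entry y i : `|y i 0| <= `|y|.
Proof.
rewrite [leRHS]/Num.Def.normr /= mx_normrE.
exact: (le_bigmax _ (fun ij : 'I_m * 'I_1 => `|y ij.1 ij.2|) (i, 0)).
Qed.

(** The ratio of [x i 0] to [s x i] and the entry [y i 0] are at most 1 in absolute value, so the
    bracket in [q] lies in [0, 2]. *)
Let q_bounds x y i : `|y| <= 1 -> 0 <= q x y i <= 2 / mu.
Proof.
move=> y1; have yi := le_trans (norm_entry y i) y1.
have mus := le_sqrt_sum_sqr mu (x i 0) mu_gt0.
have xs := abs_le_sqrt_sum_sqr mu (x i 0).
have s0 := lt_le_trans mu_gt0 mus; rewrite -/(s x i) in mus xs s0.
have : `|(s x i)^-1 * x i 0 * y i 0| <= 1.
  rewrite normrM mulr_ile1 // normrM gtr0_norm ?invr_gt0 // mulrC.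
  by rewrite ler_pdivrMr // mul1r.
rewrite ler_norml => /andP[l u].
have si : (s x i)^-1 <= mu^-1 by rewrite lef_pV2.
have si0 : 0 < (s x i)^-1 by rewrite invr_gt0.
by rewrite /q; apply/andP; split; nra.
Qed.

Lemma Hmat_ge x y v : `|y| <= 1 ->
  lamm * dot v v <= dot v (Hmat tau mu phi x y *m v).
Proof.
move=> y1; have := hess_ge x v.
rewrite mulmxBl mul_scalar_mx dotBr dotZr subr_ge0 dot_Hmat => /le_trans; apply.
rewrite lerDr mulr_ge0 ?(ltW tau_gt0) // sumr_ge0 // => i _.
by have /andP[q0 _] := q_bounds x y i y1; rewrite mulr_ge0 ?sqr_ge0.
Qed.

(* The entries of D (I - D diag(x) diag(y)) may exceed 1 / mu when x_i y_i < 0, so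
   tlam1 itself does not bound H; the slack in c6 absorbs the factor 2. *)
Lemma Hmat_le x y v : `|y| <= 1 -> 0 <= lam1 ->
  dot v (Hmat tau mu phi x y *m v) <= 2 * tlam1 tau mu lam1 * dot v v.
Proof.
move=> y1 lam10; have := hess_le x v.
rewrite mulmxBl mul_scalar_mx dotBr dotZr subr_ge0 dot_Hmat.
have : \sum_i q x y i * v i 0 ^+ 2 <= 2 / mu * dot v v.
  rewrite dotE mulr_sumr; apply: ler_sum => i _; rewrite expr2.
  have /andP[_ q2] := q_bounds x y i y1.
  by rewrite ler_wpM2r // -expr2 sqr_ge0.
move=> /(ler_wpM2l (ltW tau_gt0)).
have -> : 2 * tlam1 tau mu lam1 * dot v v
  = tau * (2 / mu * dot v v) + 2 * (lam1 * dot v v) by rewrite /tlam1; ring.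
have : 0 <= lam1 * dot v v by rewrite mulr_ge0 ?dot_ge0.
lra.
Qed.

End Objective.

(** * Progress made by one iteration *)

Section Descent.
Context {R : realType} {m : nat}.
Variables (tau mu lam1 lamm : R) (phi : 'cV[R]_m -> R).
Hypotheses (tau_gt0 : 0 < tau) (mu_gt0 : 0 < mu).
Hypotheses (lamm_gt0 : 0 < lamm) (lamm_le : lamm <= lam1).
Hypothesis phi_C : twice_differentiable phi.
Hypothesis hess_ge : forall z, loewner_le lamm%:M (hess phi z).
Hypothesis hess_le : forall z, loewner_le (hess phi z) lam1%:M.

Local Notation f := (objective tau mu phi).
Local Notation K := (kappa tau mu lam1 lamm).
Local Notation lt1 := (tlam1 tau mu lam1).

Let lt1_gt : lamm < lt1.
Proof. by rewrite /tlam1 ltr_pwDl // divr_gt0. Qed.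

Let lt1_gt0 : 0 < lt1. Proof. exact: lt_trans lt1_gt. Qed.

Lemma kappa_gt1 : 1 < K.
Proof. by rewrite /kappa ltr_pdivlMr ?mul1r. Qed.

Lemma kappa_gt0 : 0 < K. Proof. exact: lt_trans kappa_gt1. Qed.

(** A Polyak-Lojasiewicz inequality: the strongly convex lower model is minimised over the
    displacement by completing the square. *)
Lemma objective_gap_le_grad x xs :
  f x - f xs <= dot (grad f x) (grad f x) / (2 * lamm).
Proof.
have := objective_lower tau mu lam1 lamm phi tau_gt0 mu_gt0 lamm_gt0 phi_C
  hess_ge hess_le x (xs - x).
rewrite [x + _]addrC subrK; set h := xs - x; set g := grad f x.
move=> /(ler_wpM2l (ltW lamm_gt0)) H2.
have := dot_ge0 (lamm *: h + g).
rewrite dotDl !dotDr !dotZl !dotZr [dot h g]dotC => H1.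
rewrite ler_pdivlMr ?mulr_gt0 //; lra.
Qed.

Variables (x y d : 'cV[R]_m) (eta : R).
Hypotheses (y_le1 : `|y| <= 1) (eta_ge0 : 0 <= eta) (eta_lt1 : eta < 1).
Hypothesis d_cg : cg_output (Hmat tau mu phi x y) (- grad f x)
  (eta * enorm (grad f x)) d.

Let E := local_norm tau mu phi x y d ^+ 2.

Let Hge := Hmat_ge tau mu lamm phi tau_gt0 mu_gt0 hess_ge x y ^~ y_le1.

Let EE : E = dot d (Hmat tau mu phi x y *m d).
Proof.
rewrite /E /local_norm sqr_sqrtr // (le_trans _ (Hge d)) //.
by rewrite mulr_ge0 ?dot_ge0 ?(ltW lamm_gt0).
Qed.

Let d_orth := cg_output_orthogonal (Hmat tau mu phi x y) (- grad f x)
  (Hmat_sym tau mu phi phi_C x y)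
  (fun v v0 => lt_le_trans (mulr_gt0 lamm_gt0 (etrans (dot_gt0 v) v0)) (Hge v))
  (eta * enorm (grad f x)) d (mulr_ge0 eta_ge0 (sqrtr_ge0 _)) d_cg.

Lemma cg_slope : dot (grad f x) d = - E.
Proof.
have [+ _] := d_orth; rewrite dotBr dotNr -EE dotC.
by move=> /eqP; rewrite subr_eq0 => /eqP <-; rewrite opprK.
Qed.

Lemma cg_grad_le : dot (grad f x) (grad f x) <= 2 * lt1 * E.
Proof.
have [_ [d0|]] := d_orth.
  (* If [d = 0] passes the test, the gradient norm is at most [eta] times itself, so the gradient
     vanishes because [eta < 1]. *)
  have [n [_ + _]] := d_cg; rewrite d0 mulmx0 sub0r opprK => gle.
  have : enorm (grad f x) <= 0.
    by rewrite leNgt; apply/negP => g0; move: gle; rewrite leNgt gtr_pMl ?eta_lt1.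
  rewrite enorm_dot -sqrtr0 ler_sqrt // => /le_trans; apply.
  by rewrite mulr_ge0 ?sqr_ge0 // mulr_ge0 ?(ltW lt1_gt0).
rewrite EE; have := dot_mulmx_le (Hmat tau mu phi x y) (2 * lt1) d
  (Hmat_sym tau mu phi phi_C x y).
set w := Hmat tau mu phi x y *m d; set g := grad f x => wE ort.
have /le_trans -> // : dot g g <= dot w w.
  have := dot_ge0 (- g - w); move: ort.
  by rewrite !dotBl !dotBr !dotNl !dotNr [dot w g]dotC; lra.
apply: wE; last by rewrite mulr_gt0.
  by move=> v; rewrite (le_trans _ (Hge v)) // mulr_ge0 ?dot_ge0 ?(ltW lamm_gt0).
by move=> v; apply: Hmat_le => //; rewrite (le_trans (ltW lamm_gt0)).
Qed.

(** The upper model along [d] has slope [- E], and [lamm * dot d d <= E] turns its curvature term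
    into one in [E]. *)
Lemma objective_step (a : R) : 0 < a -> 0 < E ->
  f (x + a *: d) < f x - a * E + a ^+ 2 * K / 2 * E.
Proof.
move=> a0 E0; have d0 : d != 0.
  by apply: contraTneq E0 => d0; rewrite EE d0 dot0l ltxx.
have := objective_upper tau mu lam1 lamm phi tau_gt0 mu_gt0 lamm_gt0 phi_C
  hess_ge hess_le x (a *: d).
rewrite scaler_eq0 (gt_eqF a0) (negbTE d0) => /(_ isT) /lt_le_trans; apply.
rewrite !dotZr dotZl cg_slope mulrN lerD2l.
have := Hge d; rewrite -EE => dE.
have -> : lt1 / 2 * (a * (a * dot d d)) = a ^+ 2 * K / 2 * (lamm * dot d d).
  by rewrite /kappa; field; rewrite gt_eqF.
rewrite ler_wpM2l // divr_ge0 // mulr_ge0 ?sqr_ge0 // ltW // kappa_gt0 //.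
Qed.

(** The step [K^-1] minimises the bound of [objective_step] and lowers [f] by more than
    [E / (2 * K)], which cannot exceed the gap. *)
Lemma local_norm_lt_gap xs : (forall z, f xs <= f z) -> 0 < E ->
  c7 tau mu lam1 lamm * E < f x - f xs.
Proof.
move=> xsmin E0; have K0 := kappa_gt0.
have := objective_step K^-1; rewrite invr_gt0 => /(_ K0 E0) H.
have := le_lt_trans (xsmin _) H.
have -> : K^-1 ^+ 2 * K / 2 * E = K^-1 * E / 2 by field; rewrite gt_eqF.
have -> : c7 tau mu lam1 lamm * E = K^-1 * E / 2.
  by rewrite /c7; field; rewrite gt_eqF.
lra.
Qed.

Lemma gap_le_local_norm xs : f x - f xs <= K * E.
Proof.
rewrite (le_trans (objective_gap_le_grad x xs)) //.
rewrite ler_pdivrMr ?mulr_gt0 // (le_trans cg_grad_le) //.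
by rewrite le_eqVlt; apply/orP; left; apply/eqP; rewrite /kappa; field; rewrite gt_eqF.
Qed.

Variables (c2 c3 : R).
Hypotheses (c2_gt0 : 0 < c2) (c2_lt : c2 < 1 / 2) (c3_gt0 : 0 < c3) (c3_lt1 : c3 < 1).

(** Every step [a] with [a * K < 1] is accepted because [c2 < 1 / 2]. Hence the last rejected trial
    was at least [1 / K]; if none was rejected, the unit step exceeds [c3 / K] since [K > 1]. *)
Lemma line_search_decrease j : 0 < E ->
  sufficient_decrease tau mu phi c2 c3 x y d j ->
  (forall j', (j' < j)%N -> ~ sufficient_decrease tau mu phi c2 c3 x y d j') ->
  f (x + c3 ^+ j *: d) <= f x - c2 * (c3 / K) * E.
Proof.
move=> E0 /le_trans fj jmin; apply: fj; rewrite -/E lerB // ler_pM2r //.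
rewrite ler_pM2l // ler_pdivrMr ?kappa_gt0 //.
case: j jmin => [_|j jmin].
  by rewrite expr0 mul1r (le_trans (ltW c3_lt1)) // ltW // kappa_gt1.
rewrite exprS -mulrA ler_peMr ?(ltW c3_gt0) // leNgt; apply/negP => aK.
apply: (jmin j) => //; rewrite /sufficient_decrease -/E.
have a0 : 0 < c3 ^+ j by rewrite exprn_gt0.
apply: le_trans (ltW (objective_step _ a0 E0)) _.
have aE : 0 < c3 ^+ j * E by rewrite mulr_gt0.
have : 0 < (1 - c3 ^+ j * K) * (c3 ^+ j * E) by rewrite mulr_gt0 // subr_gt0.
have : 0 < (1 / 2 - c2) * (c3 ^+ j * E) by rewrite mulr_gt0 // subr_gt0.
have -> : c3 ^+ j ^+ 2 * K / 2 * E = (c3 ^+ j * K) * (c3 ^+ j * E) / 2 by ring.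
lra.
Qed.

End Descent.

(** * Geometric contraction of the gap and the iteration count *)

Theorem theorem3 (R : realType) (m : nat)
  (tau mu lam1 lamm Lphi M c2 c3 eta varpi : R)
  (phi : 'cV[R]_m -> R) (x y d : nat -> 'cV[R]_m) (xstar : 'cV[R]_m)
  (tau_gt0 : 0 < tau) (mu_gt0 : 0 < mu)
  (phi_C : twice_differentiable phi)
  (lamm_gt0 : 0 < lamm) (lamm_le : lamm <= lam1)
  (hess_ge : forall z, loewner_le lamm%:M (hess phi z))
  (hess_le : forall z, loewner_le (hess phi z) lam1%:M)
  (Lphi_ge0 : 0 <= Lphi)
  (hess_lip : forall z z',
     spectral_norm (hess phi z' - hess phi z) <= Lphi * enorm (z' - z))
  (M_gt0 : 0 < M)
  (H_lip : forall z z' u u' : 'cV[R]_m, `|u| <= 1 -> `|u'| <= 1 ->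
     spectral_norm (Hmat tau mu phi z u - Hmat tau mu phi z' u')
       <= M * (enorm (z - z') + enorm (u - u')))
  (c2_gt0 : 0 < c2) (c2_lt : c2 < 1 / 2)
  (c3_gt0 : 0 < c3) (c3_lt1 : c3 < 1)
  (eta_ge0 : 0 <= eta) (eta_lt1 : eta < 1)
  (varpi_gt0 : 0 < varpi) (varpi_le : varpi <= c5 tau mu lam1 lamm Lphi M c2)
  (xstar_min : forall z, objective tau mu phi xstar <= objective tau mu phi z)
  (run : pdNCG_run tau mu phi c2 c3 eta x y d)
  (d0_ge : varpi <= local_norm tau mu phi (x 0%N) (y 0%N) (d 0%N)) :
  let K1 := c6 tau mu lam1 lamm c2 c3 eta *
    ln ((objective tau mu phi (x 0%N) - objective tau mu phi xstar)
        / (c7 tau mu lam1 lamm * varpi ^+ 2)) in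
  exists k : nat,
    [/\ (0 < k)%N, k%:Z <= Num.ceil K1 &
      local_norm tau mu phi (x k) (y k) (d k) < varpi].
Proof.
move=> K1; case: run => y0 d_cg y_proj x_step.
have y_le1 k : `|y k| <= 1 by case: k => [//|k]; have [] := y_proj k.
pose K := kappa tau mu lam1 lamm.
have Kgt0 : 0 < K by exact: kappa_gt0.
pose gap k := objective tau mu phi (x k) - objective tau mu phi xstar.
pose E k := local_norm tau mu phi (x k) (y k) (d k) ^+ 2.
pose V := c7 tau mu lam1 lamm * varpi ^+ 2.
have c7_gt0 : 0 < c7 tau mu lam1 lamm by rewrite divr_gt0 // mulr_gt0.
have V0 : 0 < V by rewrite mulr_gt0 // exprn_gt0.
have E_ge k : varpi <= local_norm tau mu phi (x k) (y k) (d k) ->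
    varpi ^+ 2 <= E k.
  by move=> h; rewrite ler_pXn2r // nnegrE ?sqrtr_ge0 // ltW.
have gap_gt k : varpi <= local_norm tau mu phi (x k) (y k) (d k) -> V < gap k.
  move=> /E_ge h; have Ek0 : 0 < E k by rewrite (lt_le_trans _ h) // exprn_gt0.
  apply: (@le_lt_trans _ _ (c7 tau mu lam1 lamm * E k)); first by rewrite ler_pM2l.
  by apply: (local_norm_lt_gap tau mu lam1 lamm phi tau_gt0 mu_gt0 lamm_gt0
    lamm_le phi_C hess_ge hess_le (x k) (y k) (d k) eta (y_le1 k) eta_ge0 (d_cg k)).
pose rho := 2 / c6 tau mu lam1 lamm c2 c3 eta.
have eta2_gt0 : 0 < 1 - eta ^+ 2 by rewrite subr_gt0 expr_lt1.
have eta2_le1 : 1 - eta ^+ 2 <= 1 by rewrite gerBl sqr_ge0.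
have c6_gt0 : 0 < c6 tau mu lam1 lamm c2 c3 eta.
  apply: divr_gt0; first exact: (mulr_gt0 _ (exprn_gt0 2 Kgt0)).
  exact: (mulr_gt0 (mulr_gt0 (exprn_gt0 2 eta2_gt0) c2_gt0) c3_gt0).
have gapS k : varpi <= local_norm tau mu phi (x k) (y k) (d k) ->
    gap k.+1 <= expR (- rho) * gap k.
  move=> /[dup] /gap_gt gk /E_ge h.
  have Ek0 : 0 < E k by rewrite (lt_le_trans _ h) // exprn_gt0.
  have gk0 : 0 < gap k by exact: lt_trans gk.
  have [j [jdec jmin xk]] := x_step k.
  have dec : gap k.+1 <= gap k - c2 * (c3 / K) * E k.
    have := line_search_decrease tau mu lam1 lamm phi tau_gt0 mu_gt0 lamm_gt0
      lamm_le phi_C hess_ge hess_le (x k) (y k) (d k) eta (y_le1 k) eta_ge0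
      (d_cg k) c2 c3 c2_gt0 c2_lt c3_gt0 c3_lt1 j Ek0 jdec jmin.
    by rewrite -xk -/(E k) -/K /gap; lra.
  have gE : gap k <= K * E k by exact: (gap_le_local_norm tau mu lam1 lamm phi tau_gt0 mu_gt0 lamm_gt0
    lamm_le phi_C hess_ge hess_le (x k) (y k) (d k) eta (y_le1 k) eta_ge0 eta_lt1
      (d_cg k)).
  (* [rho] is [c2 * c3 / K ^+ 2] times [(1 - eta ^+ 2) ^+ 2], a factor at most 1. *)
  have rE : rho * gap k <= c2 * (c3 / K) * E k.
    have -> : rho = (1 - eta ^+ 2) ^+ 2 * (c2 * (c3 / K) / K).
      by rewrite /rho /c6 -/K; field; rewrite !gt_eqF.
    have -> : c2 * (c3 / K) * E k = c2 * (c3 / K) / K * (K * E k).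
      by field; rewrite gt_eqF.
    have cK : 0 < c2 * (c3 / K) / K by rewrite divr_gt0 // mulr_gt0 // divr_gt0.
    move: cK; set Y := _ / K => cK; rewrite -mulrA.
    apply: (@le_trans _ _ (Y * gap k)); last by rewrite ler_pM2l.
    by rewrite ler_piMl ?(ltW (mulr_gt0 cK gk0)) // exprn_ile1 // ltW.
  apply: (@le_trans _ _ ((1 - rho) * gap k)).
    by rewrite mulrBl mul1r; lra.
  by rewrite ler_wpM2r ?(ltW gk0) // expR_ge1Dx.
have V_gap0 : V < gap 0%N := gap_gt 0%N d0_ge.
have K1_gt0 : 0 < K1 by rewrite mulr_gt0 // ln_gt0 // ltr_pdivlMr // mul1r.
have ceil_gt0 : 0 < Num.ceil K1 by rewrite ceil_gt0.
pose N := `|Num.ceil K1|%N.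
have NE : N%:Z = Num.ceil K1 by rewrite /N gtz0_abs.
have [//|none] := pselect (exists k : nat, [/\ (0 < k)%N, k%:Z <= Num.ceil K1 &
  local_norm tau mu phi (x k) (y k) (d k) < varpi]).
(* Index 0 is covered by the hypothesis on the initial direction, the others by the assumed
   failure. *)
have big k : (k <= N)%N -> varpi <= local_norm tau mu phi (x k) (y k) (d k).
  case: k => [//|k kN]; rewrite leNgt; apply/negP => small; apply: none.
  by exists k.+1; rewrite -NE lez_nat.
have gap_le k : (k <= N)%N -> gap k <= expR (- rho * k%:R) * gap 0%N.
  elim: k => [|k IH] kN; first by rewrite mulr0 expR0 mul1r.
  rewrite (le_trans (gapS k (big k (ltnW kN)))) //.
  rewrite -[k.+1%:R]nat1r [- rho * _]mulrDr [- rho * 1]mulr1 expRD -mulrA ler_pM2l ?expR_gt0 //.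
  exact/IH/ltnW.
(* The gap at [N] still exceeds [V], although it has contracted [N] times; taking logarithms bounds
   [N]. *)
have VN := lt_le_trans (gap_gt N (big N (leqnn N))) (gap_le N (leqnn N)).
have gap0_gt0 : 0 < gap 0%N := lt_trans V0 V_gap0.
have : rho * N%:R <= ln (gap 0%N / V).
  rewrite -[leLHS]expRK ler_ln ?posrE ?expR_gt0 ?divr_gt0 //.
  rewrite ler_pdivlMr //; move: VN; rewrite mulNr expRN.
  by rewrite mulrC ltr_pdivlMr ?expR_gt0 // mulrC => /ltW.
have -> : ln (gap 0%N / V) = K1 / c6 tau mu lam1 lamm c2 c3 eta.
  by rewrite /K1 mulrAC mulfV ?mul1r // gt_eqF.
(* This leaves [2 * N <= K1], while [K1 <= N] by the ceiling: impossible for positive [K1]. *)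
rewrite /rho ler_pdivlMr // mulrAC divfK ?gt_eqF //.
have : K1 <= N%:R by rewrite -[N%:R]/(N%:Z%:~R) NE; exact: Num.Theory.ceil_ge.
lra.
Qed.
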